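(* Let $k$ be an algebraically closed field of characteristic zero, let $A$ be a finite-dimensional unital associative $k$-algebra, and let $x \in A$ be an element such that $AxA = A$, where $AxA$ is the two-sided ideal of $A$ generated by $x$. Then $x$ is a well-tempered element of $A$.
   Context: For a unital associative $k$-algebra $A$ and $x\in A$, the homotope $A_x$ is the vector space $A$ with the associative multiplication $a *_x b = a x b$. The augmented homotope $\widehat{A}_x$ is the unital algebra obtained from $A_x$ by externally adjoining a unit: $\widehat{A}_x = k\cdot 1 \oplus A$ as a vector space, where $1$ is the unit and $A$ is multiplied by $*_x$. There are two homomorphisms of unital algebras $\psi_1,\psi_2:\widehat{A}_x\to A$ given on $a\in A$ by $\psi_1(a)=ax$ and $\psi_2(a)=xa$. The element $x$ is called well-tempered if: (1) $A$ is a projective left $\widehat{A}_x$-module with the structure induced via $\psi_1$ (i.e. $b\cdot a=\psi_1(b)a$), and a projective right $\widehat{A}_x$-module with the structure induced via $\psi_2$ (i.e. $a\cdot b=a\psi_2(b)$); equivalently, the augmentation ideal $A_x\subset \widehat{A}_x$ is projective as a left and as a right $\widehat{A}_x$-module; and (2) $AxA=A$. *)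

(* Defs.v *)
From HB Require Import structures.
From mathcomp Require Import ssrAC all_boot all_algebra all_field.

Set Implicit Arguments.
Unset Strict Implicit.
Unset Printing Implicit Defensive.

Import GRing.Theory.
Local Open Scope ring_scope.

(* The lifting property: every linear map out of M factors through every
   surjection onto its target. Right R-modules are left modules over the
   converse ring R^c. *)
Definition projective (R : pzRingType) (M : lmodType R) : Prop :=
  forall (N P : lmodType R) (g : {linear N -> P}) (f : {linear M -> P}),
    (forall p : P, exists n : N, g n = p) ->
    exists h : {linear M -> N}, forall m : M, g (h m) = f m.

(* S as a left, respectively right, R-module by restriction of scalars
   along phi. *)
Definition lrestrict (R S : pzRingType) (phi : {rmorphism R -> S}) : Type := S.
Definition rrestrict (R S : pzRingType) (phi : {rmorphism R -> S}) : Type := S.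

Section Restrict.
Variables (R S : pzRingType) (phi : {rmorphism R -> S}).

HB.instance Definition _ := GRing.Zmodule.copy (lrestrict phi) S.
HB.instance Definition _ := GRing.Zmodule.copy (rrestrict phi) S.

Definition lrestrict_scale (r : R) (s : lrestrict phi) : lrestrict phi :=
  phi r * (s : S).

Fact lrestrict_scaleA a b v :
  lrestrict_scale a (lrestrict_scale b v) = lrestrict_scale (a * b) v.
Proof. by rewrite /lrestrict_scale rmorphM mulrA. Qed.
Fact lrestrict_scale1 : left_id 1 lrestrict_scale.
Proof. by move=> v; rewrite /lrestrict_scale rmorph1 mul1r. Qed.
Fact lrestrict_scaleDr : right_distributive lrestrict_scale +%R.
Proof. by move=> a u v; apply: mulrDr. Qed.
Fact lrestrict_scaleDl v : {morph lrestrict_scale^~ v : a b / a + b}.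
Proof. by move=> a b; rewrite /lrestrict_scale rmorphD mulrDl. Qed.

HB.instance Definition _ := GRing.Zmodule_isLmodule.Build R (lrestrict phi)
  lrestrict_scaleA lrestrict_scale1 lrestrict_scaleDr lrestrict_scaleDl.

Definition rrestrict_scale (r : R^c) (s : rrestrict phi) : rrestrict phi :=
  (s : S) * phi r.

Fact rrestrict_scaleA a b v :
  rrestrict_scale a (rrestrict_scale b v) = rrestrict_scale (a * b) v.
Proof. by rewrite /rrestrict_scale -mulrA -rmorphM. Qed.
Fact rrestrict_scale1 : left_id 1 rrestrict_scale.
Proof. by move=> v; rewrite /rrestrict_scale rmorph1 mulr1. Qed.
Fact rrestrict_scaleDr : right_distributive rrestrict_scale +%R.
Proof. by move=> a u v; apply: mulrDl. Qed.
Fact rrestrict_scaleDl v : {morph rrestrict_scale^~ v : a b / a + b}.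
Proof. by move=> a b; rewrite /rrestrict_scale rmorphD mulrDr. Qed.

HB.instance Definition _ := GRing.Zmodule_isLmodule.Build R^c (rrestrict phi)
  rrestrict_scaleA rrestrict_scale1 rrestrict_scaleDr rrestrict_scaleDl.

End Restrict.

Section Homotope.
Variables (k : fieldType) (A : algType k) (x : A).
Implicit Types a b : A.

Definition homotope_mul a b : A := a * x * b.

(* (s, a) stands for s * 1 + a, where 1 is the adjoined unit; k^o is k as a
   module over itself. *)
Definition aug_homotope (y : A) : Type := (k^o * A)%type.
Notation Ax := (aug_homotope x).

HB.instance Definition _ := GRing.Lmodule.copy Ax (k^o * A)%type.

Definition aug_one : Ax := (1, 0).
Definition aug_mul (u v : Ax) : Ax :=
  (u.1 * v.1, u.1 *: v.2 + v.1 *: u.2 + homotope_mul u.2 v.2).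

Fact aug_mulA : associative aug_mul.
Proof.
move=> [s a] [t b] [r c]; congr (_, _); rewrite /= ?mulrA // /homotope_mul.
rewrite !scalerDr !mulrDr !mulrDl -!scalerAr -!scalerAl !scalerA !mulrA.
rewrite (mulrC r s) (mulrC r t) !addrA.
by rewrite [LHS](ACl (1*2*4*6*3*5*7)).
Qed.
Fact aug_mul1 : left_id aug_one aug_mul.
Proof.
by move=> [s a]; rewrite /aug_mul /homotope_mul /= mul1r scale1r scaler0
  !mul0r !addr0.
Qed.
Fact aug_mulr1 : right_id aug_one aug_mul.
Proof.
by move=> [s a]; rewrite /aug_mul /homotope_mul /= mulr1 scale1r scaler0
  mulr0 addr0 add0r.
Qed.
Fact aug_mulDl : left_distributive aug_mul +%R.
Proof.
move=> [s a] [t b] [r c]; congr (_, _); rewrite /= ?mulrDl // /homotope_mul.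
rewrite scalerDl scalerDr !mulrDl [X in X + _]addrACA; exact: addrACA.
Qed.
Fact aug_mulDr : right_distributive aug_mul +%R.
Proof.
move=> [s a] [t b] [r c]; congr (_, _); rewrite /= ?mulrDr // /homotope_mul.
rewrite scalerDl scalerDr !mulrDr [X in X + _]addrACA; exact: addrACA.
Qed.
Fact aug_oner_neq0 : aug_one != 0.
Proof. by apply/eqP => -[] /eqP; rewrite oner_eq0. Qed.

HB.instance Definition _ := GRing.Zmodule_isNzRing.Build Ax
  aug_mulA aug_mul1 aug_mulr1 aug_mulDl aug_mulDr aug_oner_neq0.

(* Without the casts to Ax the product is read in the product ring k^o * A. *)
Fact aug_scaleAl (s : k) (u v : Ax) : s *: (u * v) = (s *: u : Ax) * v.
Proof.
congr (_, _); rewrite /= /homotope_mul; first exact: (@scalerAl _ k^o).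
by rewrite !scalerDr !scalerA -!scalerAl (mulrC s v.1).
Qed.
HB.instance Definition _ := GRing.Lmodule_isLalgebra.Build k Ax aug_scaleAl.

Fact aug_scaleAr (s : k) (u v : Ax) : s *: (u * v) = u * (s *: v : Ax).
Proof.
congr (_, _); rewrite /= /homotope_mul; first exact: (@scalerAr _ k^o).
by rewrite !scalerDr !scalerA -!scalerAr (mulrC s u.1).
Qed.
HB.instance Definition _ := GRing.Lalgebra_isAlgebra.Build k Ax aug_scaleAr.

Definition psi1 (u : Ax) : A := u.1 *: 1 + u.2 * x.
Definition psi2 (u : Ax) : A := u.1 *: 1 + x * u.2.

Fact psi1_linear : linear psi1.
Proof.
move=> s u v; rewrite /psi1 /= scalerDl mulrDl scalerDr scalerA -scalerAl.
by rewrite addrACA.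
Qed.
HB.instance Definition _ := GRing.isLinear.Build k Ax A _ psi1 psi1_linear.

Fact psi1_monoid : monoid_morphism psi1.
Proof.
split=> [|[s a] [t b]]; first by rewrite /psi1 /= scale1r mul0r addr0.
rewrite /psi1 /= /homotope_mul !mulrDl !mulrDr -!scalerAl -!scalerAr.
by rewrite !mul1r !mulr1 scalerA !mulrA !addrA.
Qed.
HB.instance Definition _ := GRing.isMonoidMorphism.Build Ax A psi1 psi1_monoid.

Fact psi2_linear : linear psi2.
Proof.
move=> s u v; rewrite /psi2 /= scalerDl mulrDr scalerDr scalerA -scalerAr.
by rewrite addrACA.
Qed.
HB.instance Definition _ := GRing.isLinear.Build k Ax A _ psi2 psi2_linear.

Fact psi2_monoid : monoid_morphism psi2.
Proof.
split=> [|[s a] [t b]]; first by rewrite /psi2 /= scale1r mulr0 addr0.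
rewrite /psi2 /= /homotope_mul !mulrDl !mulrDr -!scalerAl -!scalerAr.
by rewrite !mul1r !mulr1 scalerA !mulrA !addrA.
Qed.
HB.instance Definition _ := GRing.isMonoidMorphism.Build Ax A psi2 psi2_monoid.

(* The two-sided ideal AxA consists of the finite sums of elements u * x * v. *)
Definition in_AxA a : Prop :=
  exists (n : nat) (u v : 'I_n -> A), a = \sum_(i < n) u i * x * v i.

Definition well_tempered : Prop :=
  [/\ projective (lrestrict psi1 : lmodType Ax),
      projective (rrestrict psi2 : lmodType Ax^c)
    & forall a, in_AxA a].

End Homotope.
Arguments aug_mul {k A} x u v.
Arguments psi1 {k A} x u.
Arguments psi2 {k A} x u.

(* Main.v *)
(* Write 1 = \sum_i u_i x v_i.  The maps a |-> (0, a u_i) from A to the augmented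
   homotope are left linear for psi1, and \sum_i psi1 (0, a u_i) v_i = a, so they
   form, together with the v_i, a dual basis of A.  Symmetrically, the maps
   a |-> (0, v_i a) and the elements u_i form a dual basis for psi2. *)
Require Import Defs.
From mathcomp Require Import all_boot all_algebra all_field.
From HB Require Import structures.
Import GRing.Theory.
Local Open Scope ring_scope.

(** A lift of [f] through [g] need only be chosen at the finitely many [e i]; the coordinates
    [phi i] spread it linearly over [M]. *)
Lemma projective_dual_basis (R : pzRingType) (M : lmodType R) (n : nat)
    (e : 'I_n -> M) (phi : 'I_n -> M -> R) :
    (forall i r a b, phi i (r *: a + b) = r * phi i a + phi i b) ->
    (forall a, a = \sum_(i < n) phi i a *: e i) ->
  projective M.
Proof.
move=> phi_lin eE N P g f g_surj.
(* The index type is finite, so preimages [m i] of [f (e i)] are picked without a choice axiom. *)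
have [m gm] := fin_all_exists (fun i => g_surj (f (e i))).
pose h a : N := \sum_(i < n) phi i a *: m i.
have h_lin : linear h.
  move=> r a b; rewrite /h scaler_sumr -big_split /=.
  by apply: eq_bigr => i _; rewrite phi_lin scalerDl scalerA.
pose hL := GRing.isLinear.Build R M N _ h h_lin.
pose H : {linear M -> N} := HB.pack h hL.
exists H => a; rewrite /= /h [in RHS](eE a) !linear_sum.
by apply: eq_bigr => i _; rewrite !linearZ gm.
Qed.

Lemma projective_psi1 (k : fieldType) (A : algType k) (x : A) :
    in_AxA x 1 ->
  projective (lrestrict (psi1 x) : lmodType (aug_homotope x)).
Proof.
move=> [n [u [v uvE]]].
apply: (@projective_dual_basis (aug_homotope x) (lrestrict (psi1 x)) n v
  (fun i a => (0, (a : A) * u i))) => [i [s r] a b | a].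
  congr (_, _); rewrite /= ?mulr0 ?addr0 //.
  (* Second components; [0 *: r] comes from the zero unit part of [(0, a * u i)]. *)
  change (((s *: 1 + r * x) * (a : A) + (b : A)) * u i =
    s *: ((a : A) * u i) + 0 *: r + r * x * ((a : A) * u i) + (b : A) * u i).
  by rewrite scale0r addr0 !mulrDl -!scalerAl mul1r !mulrA.
rewrite -[LHS](mulr1 (a : A)) uvE mulr_sumr; apply: eq_bigr => i _.
change ((a : A) * (u i * x * v i) = (0 *: 1 + (a : A) * u i * x) * v i).
by rewrite scale0r add0r !mulrA.
Qed.

Lemma projective_psi2 (k : fieldType) (A : algType k) (x : A) :
    in_AxA x 1 ->
  projective (rrestrict (psi2 x) : lmodType (aug_homotope x)^c).
Proof.
move=> [n [u [v uvE]]].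
apply: (@projective_dual_basis (aug_homotope x)^c (rrestrict (psi2 x)) n u
  (fun i a => (0, v i * (a : A)))) => [i [s r] a b | a].
  congr (_, _); rewrite /= ?mul0r ?addr0 //.
  (* The product of the converse ring puts [(s, r)] to the right of [(0, v i * a)], hence the factor
     [x * r] at the end. *)
  change (v i * ((a : A) * (s *: 1 + x * r) + (b : A)) =
    0 *: r + s *: (v i * (a : A)) + v i * (a : A) * x * r + v i * (b : A)).
  by rewrite scale0r add0r !mulrDr -!scalerAr mulr1 !mulrA.
rewrite -[LHS](mul1r (a : A)) uvE mulr_suml; apply: eq_bigr => i _.
change (u i * x * v i * (a : A) = u i * (0 *: 1 + x * (v i * (a : A)))).
by rewrite scale0r add0r !mulrA.
Qed.

Theorem theorem1 (k : closedFieldType) (char0 : [pchar k] =i pred0)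
    (A : falgType k) (x : A) (AxA_full : forall a : A, in_AxA x a) :
  well_tempered x.
Proof.
have x_full := AxA_full 1.
by split; [apply: projective_psi1 | apply: projective_psi2 | ].
Qed.
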